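(* The free normed $f$-algebra $\mathrm{FNfA}[E]$ generated by a Banach space $E$ is semiprime.
   Context: All spaces are real. A vector lattice algebra is a real associative algebra that is also a vector lattice in which the product of positive elements is positive. An $f$-algebra is a vector lattice algebra such that $a\wedge b=0$ and $c\ge 0$ imply $(ac)\wedge b=0=(ca)\wedge b$. A normed $f$-algebra is an $f$-algebra equipped with a submultiplicative lattice norm. A lattice-algebra homomorphism is a linear map preserving the lattice operations and the product. Contractive means of operator norm at most $1$. An $f$-algebra $A$ is semiprime if its annihilator $N(A)=\{a\in A: ab=0\text{ for all }b\in A\}$ is $\{0\}$; for Archimedean $f$-algebras (in particular normed ones) this is equivalent to: $a^2=0$ implies $a=0$. The free normed $f$-algebra generated by $E$ is a normed $f$-algebra $\mathrm{FNfA}[E]$ together with a linear isometric embedding $\eta_E\colon E\to\mathrm{FNfA}[E]$ such that for every normed $f$-algebra $A$ and every contractive operator $T\colon E\to A$ there exists a unique lattice-algebra homomorphism $\hat T\colon\mathrm{FNfA}[E]\to A$ satisfying $\hat T\circ\eta_E=T$ and $\|\hat T\|=\|T\|$. It exists and is unique up to isometric lattice-algebra isomorphism; it is generated as a vector lattice algebra by $\eta_E(E)$. *)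

(* Defs.v *)
From HB Require Import structures.
From mathcomp Require Import all_boot all_order all_algebra.
From mathcomp Require Import all_classical all_reals all_analysis.

Set Implicit Arguments.
Unset Strict Implicit.
Unset Printing Implicit Defensive.

Import Order.TTheory GRing.Theory Num.Theory numFieldNormedType.Exports.

Local Open Scope classical_set_scope.
Local Open Scope ring_scope.

Reserved Notation "x *a y" (at level 40, left associativity).
Reserved Notation "x <=v y" (at level 70, no associativity).

(* The order is a field of the mixin, and not an order.v structure: RealDomain
   already inherits both from Lattice and from Zmodule with no intermediate
   join, so Hierarchy Builder refuses any new structure combining them. *)
HB.mixin Record Lmodule_isVectorLattice (R : realType) V & GRing.Lmodule R V := {
  vle : V -> V -> Prop;
  vmeet : V -> V -> V;
  vjoin : V -> V -> V;
  vle_refl : forall x : V, vle x x;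
  vle_anti : forall x y : V, vle x y -> vle y x -> x = y;
  vle_trans : forall x y z : V, vle x y -> vle y z -> vle x z;
  vle_vmeet : forall x y z : V, vle x (vmeet y z) <-> vle x y /\ vle x z;
  vjoin_vle : forall x y z : V, vle (vjoin x y) z <-> vle x z /\ vle y z;
  vleD2l : forall z x y : V, vle x y -> vle (z + x) (z + y);
  scale_vge0 : forall (c : R) (x : V), 0 <= c -> vle 0 x -> vle 0 (c *: x)
}.

#[short(type="vectorLatticeType")]
HB.structure Definition VectorLattice (R : realType) :=
  { V of GRing.Lmodule R V & Lmodule_isVectorLattice R V }.

Notation "x <=v y" := (vle x y) : ring_scope.

(* The modulus |x| of a vector lattice, valued in V; the notation `|x| is
   reserved for the real-valued norm. *)
Definition vmodulus (R : realType) (V : vectorLatticeType R) (x : V) : V :=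
  vjoin x (- x).

(* Algebras are not required to have a unit, so the ring and algebra structures
   of ssralg do not apply. *)
HB.mixin Record VectorLattice_isVectorLatticeAlgebra (R : realType) V
    & VectorLattice R V := {
  amul : V -> V -> V;
  amulA : associative amul;
  amulDl : left_distributive amul +%R;
  amulDr : right_distributive amul +%R;
  amulZl : forall (c : R) (x y : V), amul (c *: x) y = c *: amul x y;
  amulZr : forall (c : R) (x y : V), amul x (c *: y) = c *: amul x y;
  amul_ge0 : forall x y : V, 0 <=v x -> 0 <=v y -> 0 <=v amul x y
}.

#[short(type="vectorLatticeAlgType")]
HB.structure Definition VectorLatticeAlgebra (R : realType) :=
  { V of VectorLattice R V & VectorLattice_isVectorLatticeAlgebra R V }.

Notation "x *a y" := (amul x y) : ring_scope.

HB.mixin Record VectorLatticeAlgebra_isFAlgebra (R : realType) V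
    & VectorLatticeAlgebra R V := {
  falg_meetl : forall a b c : V,
    vmeet a b = 0 -> 0 <=v c -> vmeet (a *a c) b = 0;
  falg_meetr : forall a b c : V,
    vmeet a b = 0 -> 0 <=v c -> vmeet (c *a a) b = 0
}.

#[short(type="fAlgType")]
HB.structure Definition FAlgebra (R : realType) :=
  { V of VectorLatticeAlgebra R V & VectorLatticeAlgebra_isFAlgebra R V }.

HB.mixin Record FAlgebra_isNormed (R : realType) V
    & FAlgebra R V & NormedModule R V := {
  nfalg_norm_le : forall x y : V, vmodulus x <=v vmodulus y -> `|x| <= `|y|;
  nfalg_normM : forall x y : V, `|x *a y| <= `|x| * `|y|
}.

#[short(type="normedFAlgType")]
HB.structure Definition NormedFAlgebra (R : realType) :=
  { V of FAlgebra R V & NormedModule R V & FAlgebra_isNormed R V }.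

Definition lattice_algebra_hom (R : realType) (A B : vectorLatticeAlgType R)
    (h : {linear A -> B}) : Prop :=
  [/\ {morph h : x y / vmeet x y},
      {morph h : x y / vjoin x y} &
      {morph h : x y / x *a y}].

(* Extended-real valued: +oo exactly when T is unbounded, so an equation
   opnorm S = opnorm T with T bounded also asserts that S is bounded. *)
Definition opnorm (R : realType) (E F : normedModType R)
    (T : {linear E -> F}) : \bar R :=
  ereal_sup [set `|T x|%:E | x in [set x : E | `|x| <= 1]].

Definition contractive (R : realType) (E F : normedModType R)
    (T : {linear E -> F}) : Prop := (opnorm T <= 1%:E)%E.

(* (F, eta) has the universal property defining FNfA[E].  Uniqueness is among
   all lattice-algebra homomorphisms extending T, with no condition on their
   norm.  If the norm condition were part of it, F would not be determined by
   E = 0, since every normed f-algebra F with eta = 0 would qualify. *)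
Definition is_free_normed_falgebra (R : realType) (E : completeNormedModType R)
    (F : normedFAlgType R) (eta : {linear E -> F}) : Prop :=
  (forall x : E, `|eta x| = `|x|) /\
  forall (A : normedFAlgType R) (T : {linear E -> A}), contractive T ->
    exists That : {linear F -> A},
      [/\ lattice_algebra_hom That,
          forall x : E, That (eta x) = T x,
          opnorm That = opnorm T &
          forall S : {linear F -> A}, lattice_algebra_hom S ->
            (forall x : E, S (eta x) = T x) -> forall y : F, S y = That y].

Definition annihilator (R : realType) (A : vectorLatticeAlgType R) : set A :=
  [set a | forall b : A, a *a b = 0].

Definition semiprime (R : realType) (A : fAlgType R) : Prop :=
  @annihilator R A = [set 0].

(* Main.v *)
Require Import Defs.
From HB Require Import structures.
From mathcomp Require Import all_boot all_order all_algebra.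
From mathcomp Require Import all_classical all_reals all_analysis.
From mathcomp Require Import lra.

Set Implicit Arguments.
Unset Strict Implicit.
Unset Printing Implicit Defensive.

Import Order.TTheory GRing.Theory Num.Theory numFieldNormedType.Exports.

Local Open Scope classical_set_scope.
Local Open Scope ring_scope.

(** Why a free normed f-algebra F over E, with embedding eta, is semiprime.

    An element of F is a lattice-algebra expression in elements of eta(E), and
    dropping all products from it leaves a lattice-linear expression l: a finite
    supremum of finite infima of elements of eta(E).  The error is made of
    products, and every product x y is dominated by the square
    (|x| + |y|)^2, so each a in F satisfies |a - l| <= b^2 for some such l and
    some b >= 0 ([lattice_approx_all]).  To see this without syntax, one checks
    that the elements with such an l and b form a sub-f-algebra containing
    eta(E); the uniqueness half of the universal property forces it to be all
    of F ([free_falgebra_ind]).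

    Let a annihilate F.  Every homomorphism h : F -> R kills a, as
    h(a)^2 = h(a^2) = 0, so h(l) <= h(b)^2.  Apply this to the extension h_t of
    t f, where f is a functional of norm at most 1 and 0 < t <= 1: h_t(l) is
    linear in t, whereas h_t(b)^2 <= t^2 |b|^2 because h_t has norm at most t.
    As t tends to 0, the lattice-linear expression l takes a value <= 0 at every
    f.  That forces l <= 0 in F ([lattice_expr_le0]): if u is one of the infima
    whose supremum is l, then {e | u <= eta e} is a convex set of vectors of
    norm at least |u^+|, so the geometric Hahn-Banach theorem
    ([hahn_banach_convex]) gives a functional f >= |u^+| on it, hence a value of
    u at f that is at least |u^+|, and u^+ = 0.  The same argument for - a gives
    - l <= 0, so l = 0.

    Therefore |a| <= b^2.  In an Archimedean f-algebra an annihilator element is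
    disjoint from squares: if 0 <= c <= b^2 and c b = 0, then r c <= b for all
    r >= 1, hence c = 0 ([annihilated_scale_le], [annihilator_sqr_bound]).  So
    a = 0. *)

(** * Vector lattices *)

Section VectorLatticeTheory.
Variables (R : realType) (V : vectorLatticeType R).
Implicit Types (x y z u : V) (c : R).

Lemma vleIl x y : vmeet x y <=v x.
Proof. by case/vle_vmeet: (vle_refl (vmeet x y)). Qed.

Lemma vleIr x y : vmeet x y <=v y.
Proof. by case/vle_vmeet: (vle_refl (vmeet x y)). Qed.

Lemma vleUl x y : x <=v vjoin x y.
Proof. by case/vjoin_vle: (vle_refl (vjoin x y)). Qed.

Lemma vleUr x y : y <=v vjoin x y.
Proof. by case/vjoin_vle: (vle_refl (vjoin x y)). Qed.

Lemma vmeetC x y : vmeet x y = vmeet y x.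
Proof.
by apply: vle_anti; apply/vle_vmeet; split; (exact: vleIl || exact: vleIr).
Qed.

Lemma vjoinC x y : vjoin x y = vjoin y x.
Proof.
by apply: vle_anti; apply/vjoin_vle; split; (exact: vleUl || exact: vleUr).
Qed.

Lemma vle_meet2 x y z u : x <=v z -> y <=v u -> vmeet x y <=v vmeet z u.
Proof.
move=> xz yu; apply/vle_vmeet; split.
- exact: vle_trans (vleIl _ _) xz.
- exact: vle_trans (vleIr _ _) yu.
Qed.

Lemma vle_join2 x y z u : x <=v z -> y <=v u -> vjoin x y <=v vjoin z u.
Proof.
move=> xz yu; apply/vjoin_vle; split.
- exact: vle_trans xz (vleUl _ _).
- exact: vle_trans yu (vleUr _ _).
Qed.

Lemma vle_add2l z x y : z + x <=v z + y <-> x <=v y.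
Proof.
by split=> [/(vleD2l (- z))|/(vleD2l z)//]; rewrite !addKr.
Qed.

Lemma vle_add2r z x y : x + z <=v y + z <-> x <=v y.
Proof. by rewrite ![_ + z]addrC; exact: vle_add2l. Qed.

Lemma vle_add x y z u : x <=v z -> y <=v u -> x + y <=v z + u.
Proof. by move=> /(vle_add2r y) xz /(vle_add2l z); exact: vle_trans. Qed.

Lemma vsub_ge0 x y : 0 <=v y - x <-> x <=v y.
Proof. by rewrite -(vle_add2r x) add0r subrK. Qed.

Lemma vle_opp x y : - x <=v - y <-> y <=v x.
Proof. by rewrite -vsub_ge0 opprK addrC vsub_ge0. Qed.

Lemma vle_opp_add x y z : x <=v y + z -> - y <=v - x + z.
Proof.
by move=> /(vleD2l (- y - x)); rewrite subrK [- y - x]addrC -addrA addKr.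
Qed.

Lemma vadd_ge0 x y : 0 <=v x -> 0 <=v y -> 0 <=v x + y.
Proof. by rewrite -{3}[0]addr0; exact: vle_add. Qed.

Lemma vle_addl x y : 0 <=v y -> x <=v x + y.
Proof. by move=> ?; rewrite -{1}[x]addr0; apply/vle_add2l. Qed.

Lemma vle_addr x y : 0 <=v y -> x <=v y + x.
Proof. by rewrite addrC; exact: vle_addl. Qed.

Lemma vle_scale c x y : 0 <= c -> x <=v y -> c *: x <=v c *: y.
Proof.
by move=> c0 /vsub_ge0 xy; apply/vsub_ge0; rewrite -scalerBr; exact: scale_vge0.
Qed.

Lemma vjoinDr x y z : vjoin x y + z = vjoin (x + z) (y + z).
Proof.
apply: vle_anti.
- rewrite -[vjoin (x + z) _](subrK z); apply/vle_add2r/vjoin_vle; split;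
  apply/(vle_add2r z); rewrite subrK; [exact: vleUl|exact: vleUr].
- by apply/vjoin_vle; split; apply/vle_add2r; [exact: vleUl|exact: vleUr].
Qed.

Lemma vmeetDr x y z : vmeet x y + z = vmeet (x + z) (y + z).
Proof.
apply: vle_anti.
- by apply/vle_vmeet; split; apply/vle_add2r; [exact: vleIl|exact: vleIr].
- rewrite -[vmeet (x + z) _](subrK z); apply/vle_add2r/vle_vmeet; split;
  apply/(vle_add2r z); rewrite subrK; [exact: vleIl|exact: vleIr].
Qed.

Lemma voppU x y : - vjoin x y = vmeet (- x) (- y).
Proof.
apply: vle_anti.
- by apply/vle_vmeet; split; apply/vle_opp; [exact: vleUl|exact: vleUr].
- apply/vle_opp; rewrite opprK; apply/vjoin_vle; split; apply/vle_opp;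
  rewrite opprK; [exact: vleIl|exact: vleIr].
Qed.

Lemma voppI x y : - vmeet x y = vjoin (- x) (- y).
Proof. by rewrite -[RHS]opprK voppU !opprK. Qed.

Lemma vscaleU c x y : 0 <= c -> c *: vjoin x y = vjoin (c *: x) (c *: y).
Proof.
rewrite le0r => /predU1P[->|c0].
  rewrite !scale0r; apply: vle_anti; first exact: vleUl.
  by apply/vjoin_vle; split; exact: vle_refl.
have cN := lt0r_neq0 c0.
apply: vle_anti.
- rewrite -[vjoin (c *: x) _](scalerKV cN); apply: vle_scale (ltW c0) _.
  have cV (z t : V) : c *: z <=v t -> z <=v c^-1 *: t.
    by rewrite -[in X in _ -> X](scalerK cN z); apply: vle_scale;
      rewrite invr_ge0 ltW.
  by apply/vjoin_vle; split; apply: cV; [exact: vleUl|exact: vleUr].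
- apply/vjoin_vle; split; apply: (vle_scale (ltW c0));
  [exact: vleUl|exact: vleUr].
Qed.

Lemma vscaleI c x y : 0 <= c -> c *: vmeet x y = vmeet (c *: x) (c *: y).
Proof.
by move=> c0; apply: oppr_inj; rewrite -scalerN !voppI vscaleU// !scalerN.
Qed.

Lemma vmeetDjoin x y : vmeet x y + vjoin x y = x + y.
Proof.
have -> : vjoin x y = - vmeet x y + (x + y).
  by rewrite voppI vjoinDr addKr [x + y]addrC addKr vjoinC.
by rewrite addNKr.
Qed.

(** Vector lattices are automatically distributive: the modular identity
    [vmeetDjoin] recovers t from its meet and join with z, so an upper bound
    for the meets of x and y with z bounds x and y themselves. *)
Lemma vmeetUr z x y : vmeet z (vjoin x y) = vjoin (vmeet z x) (vmeet z y).
Proof.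
apply: vle_anti; last first.
  by apply/vjoin_vle; split; apply: vle_meet2; (exact: vle_refl ||
    exact: vleUl || exact: vleUr).
set w := vjoin (vmeet _ _) _.
have le_w t : vmeet z t <=v w -> t <=v vjoin x y ->
    t <=v w + vjoin z (vjoin x y) - z.
  move=> ztw txy; rewrite -[t](addKr z) -(vmeetDjoin z t) addrC; apply/vle_add2r.
  by apply: vle_add => //; apply: vle_join2 => //; exact: vle_refl.
have xy_le : vjoin x y <=v w + vjoin z (vjoin x y) - z.
  by apply/vjoin_vle; split; apply: le_w; (exact: vleUl || exact: vleUr).
apply/(vle_add2r (vjoin z (vjoin x y))); rewrite vmeetDjoin addrC.
by apply/(vle_add2r (- z)); rewrite addrK.
Qed.

Definition vpos x := vjoin x 0.

Lemma vpos_ge0 x : 0 <=v vpos x. Proof. exact: vleUr. Qed.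

Lemma vpos_ge x : x <=v vpos x. Proof. exact: vleUl. Qed.

Lemma vpos_le x y : 0 <=v y -> x <=v y -> vpos x <=v y.
Proof. by move=> y0 xy; apply/vjoin_vle. Qed.

Lemma vposB x : vpos x - vpos (- x) = x.
Proof.
rewrite /vpos voppU opprK oppr0 vmeetC -[vjoin x 0]/(vpos x).
have := vmeetDjoin 0 x; rewrite vjoinC add0r.
by rewrite -/(vpos x) addrC vmeetC [vmeet x 0]vmeetC.
Qed.

Lemma vposI x : vmeet (vpos x) (vpos (- x)) = 0.
Proof.
have -> : vpos (- x) = - x + vpos x by rewrite -{2}(vposB x) opprB subrK.
have -> : vmeet (vpos x) (- x + vpos x) = vmeet 0 (- x) + vpos x.
  by rewrite vmeetDr add0r.
have -> : vmeet 0 (- x) = - vpos x by rewrite voppU oppr0 vmeetC.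
by rewrite addNr.
Qed.

Lemma vpos_eq0 x : vpos x = 0 -> x <=v 0.
Proof. by move=> <-; exact: vpos_ge. Qed.

(** Since x and - x both lie below |x|, their sum 0 lies below 2 |x|. *)
Lemma vmodulus_ge0 x : 0 <=v vmodulus x.
Proof.
have: 0 <=v vmodulus x + vmodulus x.
  by rewrite -(subrr x); apply: vle_add; [exact: vleUl|exact: vleUr].
have h0 : 0 <= 2^-1 :> R by rewrite invr_ge0.
rewrite -mulr2n -scaler_nat => /(scale_vge0 _ _ h0).
by rewrite scalerA mulVf ?pnatr_eq0// scale1r.
Qed.

Lemma vmodulusN x : vmodulus (- x) = vmodulus x.
Proof. by rewrite /vmodulus opprK vjoinC. Qed.

End VectorLatticeTheory.

(** * Products and annihilators in f-algebras *)

Section FAlgebraTheory.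
Variables (R : realType) (A : vectorLatticeAlgType R).
Implicit Types (x y z : A).

Lemma amul0l x : 0 *a x = 0.
Proof. by have := amulZl 0 (0 : A) x; rewrite !scale0r. Qed.

Lemma amulNl x y : (- x) *a y = - (x *a y).
Proof. by rewrite -scaleN1r amulZl scaleN1r. Qed.

Lemma amulNr x y : x *a (- y) = - (x *a y).
Proof. by rewrite -scaleN1r amulZr scaleN1r. Qed.

Lemma vle_mul2r z x y : 0 <=v z -> x <=v y -> x *a z <=v y *a z.
Proof.
by move=> z0 /vsub_ge0 xy; apply/vsub_ge0; rewrite -amulNl -amulDl; exact: amul_ge0.
Qed.

Lemma vle_mul2l z x y : 0 <=v z -> x <=v y -> z *a x <=v z *a y.
Proof.
by move=> z0 /vsub_ge0 xy; apply/vsub_ge0; rewrite -amulNr -amulDr; exact: amul_ge0.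
Qed.

(** Expanding the two products of positive elements (|x| - x) (|y| + y) and
    (|x| + x) (|y| - y) bounds x y by |x| |y|. *)
Lemma amul_le_sqr x y :
  x *a y <=v (vmodulus x + vmodulus y) *a (vmodulus x + vmodulus y).
Proof.
set p := vmodulus x; set q := vmodulus y.
have [p0 q0] : 0 <=v p /\ 0 <=v q by split; exact: vmodulus_ge0.
apply: (@vle_trans _ _ _ (p *a q)); last first.
  apply: (@vle_trans _ _ _ ((p + q) *a q)).
    by apply: vle_mul2r => //; exact: vle_addl.
  by apply: vle_mul2l; [exact: vadd_ge0|exact: vle_addr].
have ge0 : 0 <=v p *a q - x *a y + (p *a q - x *a y).
  (* The terms p *a y and x *a q cancel in the sum of the two products. *)
  have le1 : 0 <=v (p *a q - x *a y) + (p *a y - x *a q).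
    have -> : (p *a q - x *a y) + (p *a y - x *a q) = (p - x) *a (q + y).
      rewrite amulDr !amulDl !amulNl [RHS]addrACA [LHS]addrACA.
      by congr (_ + _); exact: addrC.
    apply: amul_ge0; first by apply/vsub_ge0; exact: vleUl.
    by rewrite -[y]opprK; apply/vsub_ge0; exact: vleUr.
  have le2 : 0 <=v (p *a q - x *a y) - (p *a y - x *a q).
    have -> : (p *a q - x *a y) - (p *a y - x *a q) = (p + x) *a (q - y).
      by rewrite amulDr !amulDl !amulNr opprB addrACA [- _ - _]addrC.
    apply: amul_ge0; first by rewrite -[x]opprK; apply/vsub_ge0; exact: vleUr.
    by apply/vsub_ge0; exact: vleUl.
  by have := vadd_ge0 le1 le2; rewrite addrACA subrr addr0.
have h0 : 0 <= 2^-1 :> R by rewrite invr_ge0.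
move: ge0; rewrite -mulr2n -scaler_nat => /(scale_vge0 _ _ h0).
by rewrite scalerA mulVf ?pnatr_eq0// scale1r => /vsub_ge0.
Qed.

End FAlgebraTheory.

Section Annihilated.
Variables (R : realType) (A : fAlgType R).
Implicit Types (a b c : A).

(** The products a^+ b and a^- b are equal because their difference a b is 0,
    and disjoint by the f-algebra axiom; so both vanish. *)
Lemma annihilated_vpos a b : 0 <=v b -> a *a b = 0 -> vpos a *a b = 0.
Proof.
move=> b0 ab0.
have pos_neg : vpos a *a b = vpos (- a) *a b.
  by apply/eqP; rewrite -subr_eq0 -amulNl -amulDl vposB ab0.
have := falg_meetl _ _ _ (vposI a) b0.
rewrite vmeetC => /(falg_meetl _ _ b)/(_ b0).
rewrite -pos_neg => <-.
by apply: vle_anti; [apply/vle_vmeet; split; exact: vle_refl|exact: vleIl].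
Qed.

(** Let p and m be the positive and negative parts of r c - b.  Since m >= b - r c
    and c b = 0, m b >= b^2; as p is disjoint from m, hence from m b, it is
    disjoint from b^2 and from c.  But p <= r c, so p = 0. *)
Lemma annihilated_scale_le c b (r : R) :
  0 <=v c -> 0 <=v b -> c <=v b *a b -> c *a b = 0 -> 1 <= r -> r *: c <=v b.
Proof.
move=> c0 b0 cbb cb r1; have r0 : 0 <= r by exact: le_trans r1.
set d := r *: c - b; set p := vpos d; set m := vpos (- d).
have bb_le : b *a b <=v m *a b.
  have -> : m = p - d by rewrite -[X in _ - X](vposB d) opprB addrC subrK.
  rewrite amulDl amulNl amulDl amulNl amulZl cb scaler0 add0r opprK.
  by apply: vle_addr; apply: amul_ge0 => //; exact: vpos_ge0.
have pm : vmeet p (m *a b) = 0.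
  by rewrite vmeetC; apply: falg_meetl => //; rewrite vmeetC; exact: vposI.
have pc : vmeet p c = 0.
  apply: vle_anti; last by apply/vle_vmeet; split => //; exact: vpos_ge0.
  rewrite -pm; apply: vle_meet2; first exact: vle_refl.
  exact: vle_trans bb_le.
(* Here p lies below both r p and r c, whose meet is r (p /\ c) = 0. *)
have p_le0 : p <=v 0.
  rewrite -(scaler0 _ r) -pc vscaleI//; apply/vle_vmeet; split.
    rewrite -{1}[p]scale1r -[X in X <=v _]addr0 -[r](subrK 1) scalerDl addrC.
    apply: vle_add; last exact: vle_refl.
    by apply: scale_vge0; [rewrite subr_ge0|exact: vpos_ge0].
  apply: vpos_le; first exact: scale_vge0.
  by apply/vsub_ge0; rewrite opprB addrC subrK.
apply/vsub_ge0/vle_opp; rewrite oppr0 opprB.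
exact: vle_trans (vpos_ge d) p_le0.
Qed.

End Annihilated.

Section NormedFAlgebraTheory.
Variables (R : realType) (A : normedFAlgType R).
Implicit Types (a b c : A).

Lemma norm_le_vle a b : 0 <=v a -> a <=v b -> `|a| <= `|b|.
Proof.
move=> a0 ab; apply: nfalg_norm_le.
suff : vmodulus a <=v b by move/vle_trans; apply; exact: vleUl.
apply/vjoin_vle; split => //; apply: vle_trans ab; apply: vle_trans (a0).
by rewrite -oppr0; apply/vle_opp.
Qed.

(** The norm plays the part of the Archimedean property: r |c| <= |b| for all
    r >= 1. *)
Lemma annihilated_sqr_bound c b :
  0 <=v c -> 0 <=v b -> c <=v b *a b -> c *a b = 0 -> c = 0.
Proof.
move=> c0 b0 cbb cb; apply/eqP; rewrite -normr_eq0 eq_le normr_ge0 andbT leNgt.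
apply/negP => nc; pose r := `|b| / `|c| + 1.
have r1 : 1 <= r by rewrite lerDr divr_ge0.
have r0 : 0 <= r by exact: le_trans r1.
have := norm_le_vle (scale_vge0 _ _ r0 c0) (annihilated_scale_le c0 b0 cbb cb r1).
rewrite normrZ ger0_norm// mulrDl divfK ?gt_eqF// mul1r.
by rewrite leNgt ltrDl nc.
Qed.

Lemma annihilator_sqr_bound a b :
  annihilator a -> 0 <=v b -> a <=v b *a b -> - a <=v b *a b -> a = 0.
Proof.
move=> Na b0 ab Nab; have bb := amul_ge0 _ _ b0 b0.
have vpos_0 x : x *a b = 0 -> x <=v b *a b -> vpos x = 0.
  move=> xb xbb; apply: (annihilated_sqr_bound (vpos_ge0 x) b0).
    exact: vpos_le bb xbb.
  exact: annihilated_vpos b0 xb.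
by rewrite -(vposB a) !vpos_0 ?subrr// amulNl Na oppr0.
Qed.

End NormedFAlgebraTheory.

(** * Lattice-linear expressions *)

Section LatticeExpressions.
Variable R : realType.

(** Closure under binary meets, rather than a meet over a list: the morphism
    and bound lemmas below are then plain inductions. *)
Inductive fin_meets (V : vectorLatticeType R) (S : set V) : V -> Prop :=
| fin_meets_base x : S x -> fin_meets S x
| fin_meets_meet x y : fin_meets S x -> fin_meets S y -> fin_meets S (vmeet x y).

Inductive fin_joins (V : vectorLatticeType R) (S : set V) : V -> Prop :=
| fin_joins_base x : S x -> fin_joins S x
| fin_joins_join x y : fin_joins S x -> fin_joins S y -> fin_joins S (vjoin x y).

Lemma fin_meets_morph (V W : vectorLatticeType R) (S : set V) (T : set W)
    (f : V -> W) : {morph f : x y / vmeet x y} ->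
  (forall x, S x -> fin_meets T (f x)) -> forall x, fin_meets S x -> fin_meets T (f x).
Proof.
move=> fI fS x; elim=> [{}x /fS//|{}x y _ xT _ yT].
by rewrite fI; exact: fin_meets_meet.
Qed.

Lemma fin_joins_morph (V W : vectorLatticeType R) (S : set V) (T : set W)
    (f : V -> W) : {morph f : x y / vjoin x y} ->
  (forall x, S x -> fin_joins T (f x)) -> forall x, fin_joins S x -> fin_joins T (f x).
Proof.
move=> fU fS x; elim=> [{}x /fS//|{}x y _ xT _ yT].
by rewrite fU; exact: fin_joins_join.
Qed.

(** A lower bound of f on the elements of S above u is one of f u: the
    elements of S from which u is built all lie above u. *)
Lemma fin_meets_ge (V W : vectorLatticeType R) (S : set V) (f : V -> W) u d :
    {morph f : x y / vmeet x y} -> fin_meets S u ->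
  (forall s, S s -> u <=v s -> d <=v f s) -> d <=v f u.
Proof.
move=> fI; elim=> [x Sx|x y _ IHx _ IHy] df.
  by apply: df => //; exact: vle_refl.
rewrite fI; apply/vle_vmeet; split; [apply: IHx|apply: IHy] => s Ss us.
  by apply: df => //; apply: vle_trans us; exact: vleIl.
by apply: df => //; apply: vle_trans us; exact: vleIr.
Qed.

Lemma fin_meets_has_ge (V : vectorLatticeType R) (S : set V) u :
  fin_meets S u -> exists2 s, S s & u <=v s.
Proof.
elim=> [x Sx|x y _ [s Ss xs] _ _]; first by exists x => //; exact: vle_refl.
by exists s => //; apply: vle_trans xs; exact: vleIl.
Qed.

Lemma fin_joins_le (V : vectorLatticeType R) (S : set V) l z :
  fin_joins S l -> (forall s, S s -> s <=v l -> s <=v z) -> l <=v z.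
Proof.
elim=> [x Sx|x y _ IHx _ IHy] df.
  by apply: df => //; exact: vle_refl.
apply/vjoin_vle; split; [apply: IHx|apply: IHy] => s Ss us.
  by apply: df => //; apply: vle_trans us _; exact: vleUl.
by apply: df => //; apply: vle_trans us _; exact: vleUr.
Qed.

Variables (E : lmodType R) (V : vectorLatticeType R) (eta : {linear E -> V}).

(** The vector sublattice generated by the range of eta, in normal form.  The
    normal form reduces the sign of an element to that of its finite meets. *)
Definition lattice_expr : set V := fin_joins (fin_meets (range eta)).

Lemma lattice_expr_gen e : lattice_expr (eta e).
Proof. by apply/fin_joins_base/fin_meets_base; exists e. Qed.

Lemma lattice_exprJ x y :
  lattice_expr x -> lattice_expr y -> lattice_expr (vjoin x y).
Proof. exact: fin_joins_join. Qed.

Lemma lattice_exprD x y :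
  lattice_expr x -> lattice_expr y -> lattice_expr (x + y).
Proof.
move=> Lx Ly.
apply: (fin_joins_morph (f := +%R^~ y)) Lx => [u v|u Mu]; first exact: vjoinDr.
apply: (fin_joins_morph (f := +%R u)) Ly => [v w|v Mv].
  by rewrite ![u + _]addrC vjoinDr.
apply: fin_joins_base.
apply: (fin_meets_morph (f := +%R^~ v)) Mu => [w z|_ [e _ <-]]; first exact: vmeetDr.
apply: (fin_meets_morph (f := +%R (eta e))) Mv => [w z|_ [e' _ <-]].
  by rewrite ![eta e + _]addrC vmeetDr.
by apply: fin_meets_base; exists (e + e') => //; rewrite linearD.
Qed.

Lemma lattice_exprI x y :
  lattice_expr x -> lattice_expr y -> lattice_expr (vmeet x y).
Proof.
move=> Lx Ly.
apply: (fin_joins_morph (f := vmeet x)) Ly => [u v|u Mu]; first exact: vmeetUr.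
rewrite vmeetC.
apply: (fin_joins_morph (f := vmeet u)) Lx => [v w|v Mv]; first exact: vmeetUr.
exact/fin_joins_base/fin_meets_meet.
Qed.

(** Negation exchanges joins and meets; distributivity, through
    [lattice_exprI], restores the normal form. *)
Lemma lattice_exprN x : lattice_expr x -> lattice_expr (- x).
Proof.
elim=> [{}x|{}x y _ Lx _ Ly]; last by rewrite voppU; exact: lattice_exprI.
elim=> [_ [e _ <-]|{}x y _ Lx _ Ly]; last by rewrite voppI; exact: lattice_exprJ.
by rewrite -linearN; exact: lattice_expr_gen.
Qed.

Lemma lattice_exprZ (c : R) x : 0 <= c -> lattice_expr x -> lattice_expr (c *: x).
Proof.
move=> c0.
apply: fin_joins_morph => [u v|u Mu]; first exact: vscaleU.
apply: fin_joins_base.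
apply: (fin_meets_morph (f := *:%R c)) Mu => [v w|_ [e _ <-]]; first exact: vscaleI.
by apply: fin_meets_base; exists (c *: e) => //; rewrite linearZ.
Qed.

End LatticeExpressions.

(** * Sublinear functionals and the geometric Hahn-Banach theorem *)

Section HahnBanach.
Variables (R : realType) (E : normedModType R).
Implicit Types (q : E -> R) (x y : E).

Definition sublinear q :=
  (forall x y, q (x + y) <= q x + q y) /\
  (forall r x, 0 < r -> q (r *: x) <= r * q x).

Definition convex_subset (S : set E) := forall x y (a b : R),
  S x -> S y -> 0 <= a -> 0 <= b -> a + b = 1 -> S (a *: x + b *: y).

Lemma sublinear0 q : sublinear q -> q 0 = 0.
Proof.
move=> [qD qZ]; apply: le_anti; apply/andP; split.
  have h0 : 0 < 2^-1 :> R by rewrite invr_gt0.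
  by have := qZ _ 0 h0; rewrite scaler0; lra.
by have := qD 0 0; rewrite addr0; lra.
Qed.

Lemma sublinear_lower q x : sublinear q -> - q (- x) <= q x.
Proof.
move=> qs; have [qD _] := qs; have := qD x (- x).
by rewrite subrr sublinear0//; lra.
Qed.

(** An infimum of functionals inherits sublinearity when the family is directed
    in this weak sense; chains and the family of [sublinear_push] are both
    instances. *)
Lemma sublinear_inf (I : Type) (A : set I) (g : I -> E -> R) :
    A !=set0 ->
    (forall x, has_lbound [set g i x | i in A]) ->
    (forall i j x y, A i -> A j ->
      exists2 k, A k & g k (x + y) <= g i x + g j y) ->
    (forall i r x, A i -> 0 < r ->
      exists2 k, A k & g k (r *: x) <= r * g i x) ->
  sublinear (fun x => inf [set g i x | i in A]).
Proof.
move=> [i0 Ai0] lb gD gZ.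
have le_g k x : A k -> inf [set g i x | i in A] <= g k x.
  by move=> Ak; apply: ge_inf => //; exists k.
split=> [x y|r x r0].
- rewrite -lerBlDr; apply: lb_le_inf; first by exists (g i0 x), i0.
  move=> _ [i Ai <-]; rewrite lerBlDl -lerBlDr.
  apply: lb_le_inf; first by exists (g i0 y), i0.
  move=> _ [j Aj <-]; rewrite lerBlDl.
  have [k Ak gk] := gD i j x y Ai Aj.
  exact: le_trans (le_g _ _ Ak) gk.
- rewrite -ler_pdivrMl//; apply: lb_le_inf; first by exists (g i0 x), i0.
  move=> _ [i Ai <-]; rewrite ler_pdivrMl//.
  have [k Ak gk] := gZ i r x Ai r0.
  exact: le_trans (le_g _ _ Ak) gk.
Qed.

(** The new functional is x |-> inf (q (x + t c) - t d) over t >= 0 and c in S.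
    The pair (1, c) shows that it is at most - d at - c.  It is finite because
    q >= d on S, and convexity of S makes it subadditive. *)
Lemma sublinear_push q (S : set E) (d : R) :
  sublinear q -> S !=set0 -> convex_subset S -> (forall x, S x -> d <= q x) ->
  exists q', [/\ sublinear q', (forall x, q' x <= q x) &
    forall x, S x -> q' (- x) <= - d].
Proof.
move=> qs [c0 Sc0] Sconv Sd; have [qD qZ] := qs.
pose A : set (R * E) := [set i | 0 <= i.1 /\ S i.2].
pose g (i : R * E) x := q (x + i.1 *: i.2) - i.1 * d.
have lbA x : lbound [set g i x | i in A] (- q (- x)).
  move=> _ [[t c] [/= t0 Sc] <-]; rewrite /g/=.
  have tq : t * d <= q (t *: c).
    move: t0; rewrite le0r => /predU1P[->|t0].
      by rewrite scale0r mul0r sublinear0.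
    rewrite -ler_pdivlMl//; apply: le_trans (Sd _ Sc) _.
    by have := qZ t^-1 (t *: c); rewrite scalerK ?gt_eqF// invr_gt0; exact.
  have := qD (- x) (x + t *: c); rewrite addKr; lra.
have hlb x : has_lbound [set g i x | i in A] by exists (- q (- x)); exact: lbA.
have le_g k x : A k -> inf [set g i x | i in A] <= g k x.
  by move=> Ak; apply: ge_inf => //; exists k.
exists (fun x => inf [set g i x | i in A]); split.
- apply: sublinear_inf => //; first by exists (0, c0).
  + move=> [t c] [s e] x y [/= t0 Sc] [/= s0 Se].
    have [ts0|ts0] := eqVneq (t + s) 0.
      have [-> ->] : t = 0 /\ s = 0 by split; lra.
      exists (0, c0) => //; rewrite /g/= !scale0r !mul0r !addr0 !subr0.
      exact: qD.
    pose k := (t + s)^-1.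
    exists (t + s, (t * k) *: c + (s * k) *: e).
      split=> /=; first exact: addr_ge0.
      by apply: Sconv => //; rewrite ?mulr_ge0 ?invr_ge0 ?addr_ge0// -mulrDl divff.
    rewrite /g/= scalerDr !scalerA ![(t + s) * (_ * _)]mulrCA divff// !mulr1.
    rewrite addrACA mulrDl; have := qD (x + t *: c) (y + s *: e); lra.
  + move=> [t c] r x [/= t0 Sc] r0; exists (r * t, c).
      by split=> //=; rewrite mulr_ge0// ltW.
    rewrite /g/= -scalerA -scalerDr -mulrA mulrBr lerD2r; exact: qZ.
- move=> x; apply: le_trans (le_g (0, c0) _ _) _; first by split.
  by rewrite /g/= scale0r mul0r addr0 subr0.
- move=> c Sc; apply: le_trans (le_g (1, c) _ _) _; first by split.
  by rewrite /g/= scale1r addNr sublinear0// mul1r sub0r.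
Qed.

(** By Zorn's lemma; the pointwise infimum of a chain is bounded below because
    a sublinear f satisfies - f (- x) <= f x. *)
Lemma minimal_sublinear q : sublinear q ->
  exists q', [/\ sublinear q', (forall x, q' x <= q x) &
    forall q'', sublinear q'' -> (forall x, q'' x <= q' x) -> q'' = q'].
Proof.
move=> qs.
pose T := {f : E -> R | sublinear f /\ forall x, f x <= q x}.
pose mkT f (fs : sublinear f) (fq : forall x, f x <= q x) : T :=
  exist _ f (conj fs fq).
pose r (f g : T) := `[< forall x, sval g x <= sval f x >].
have [|||A Atot|[m [ms mq]] mmin] := @Zorn T r.
- by move=> f; apply/asboolP.
- move=> f g h /asboolP fg /asboolP gh; apply/asboolP => x.
  exact: le_trans (gh x) (fg x).
- move=> [f Hf] [g Hg] /asboolP/= fg /asboolP/= gf.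
  have fgE : f = g by apply/funext => x; apply/le_anti; rewrite fg gf.
  by move: Hf; rewrite fgE => Hf; congr exist; exact: Prop_irrelevance.
- have [[f0 Af0]|A0] := pselect (A !=set0); last first.
    exists (mkT q qs (fun x => lexx _)) => f Af.
    by case: A0; exists f.
  pose g (i : T) := sval i.
  have lbA x : has_lbound [set g i x | i in A].
    exists (- q (- x)) => _ [[f [fs fq]] Af <-]; rewrite /g/=.
    by apply: le_trans (sublinear_lower x fs); rewrite lerN2.
  have ginf : sublinear (fun x => inf [set g i x | i in A]).
    apply: sublinear_inf => //; first by exists f0.
    + move=> i j x y Ai Aj; have [] := Atot i j Ai Aj => /asboolP ij.
        exists j => //; have [[+ _] _] := svalP j => /(_ x y)/le_trans; apply.
        by rewrite lerD2r ij.
      exists i => //; have [[+ _] _] := svalP i => /(_ x y)/le_trans; apply.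
      by rewrite lerD2l ij.
    + by move=> i s x Ai s0; exists i => //; have [[_ +] _] := svalP i; apply.
  have infq x : inf [set g i x | i in A] <= q x.
    apply: le_trans ((svalP f0).2 x); apply: ge_inf => //; exact/imageP.
  exists (mkT _ ginf infq) => f Af; apply/asboolP => x /=.
  apply: ge_inf => //; exact/imageP.
- exists m; split => // f fs fm.
  have fq x : f x <= q x by exact: le_trans (fm x) (mq x).
  have mf : r (mkT m ms mq) (mkT f fs fq) by apply/asboolP.
  exact: (congr1 sval (mmin _ mf)).
Qed.

(** Push the norm down along S, then take a minimal sublinear functional below.
    A minimal f is linear: pushing it along the single vector y with d = f y
    changes nothing, so f (- y) <= - f y. *)
Lemma hahn_banach_convex (S : set E) (d : R) :
    S !=set0 -> convex_subset S -> (forall x, S x -> d <= `|x|) ->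
  exists f : {linear E -> R^o}, (forall x, f x <= `|x|) /\
    forall x, S x -> d <= f x.
Proof.
move=> S0 Sconv Sd.
have nrms : sublinear (fun x => `|x|).
  by split=> [x y|r x r0]; [exact: ler_normD|rewrite normrZ gtr0_norm].
have [p [ps pn pS]] := sublinear_push nrms S0 Sconv Sd.
have [f [fs fp fmin]] := minimal_sublinear ps.
have fN y : f (- y) = - f y.
  have y1 : [set y] !=set0 by exists y.
  have cvy : convex_subset [set y].
    by move=> _ _ a b -> -> _ _ ab; rewrite /= -scalerDl ab scale1r.
  have [|f' [f's f'f f'y]] := sublinear_push fs y1 cvy (d := f y).
    by move=> _ ->.
  have := f'y y erefl; rewrite (fmin f')// => fy.
  apply/le_anti; rewrite fy/=.
  by have := sublinear_lower (- y) fs; rewrite opprK.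
have fD x y : f (x + y) = f x + f y.
  apply/le_anti; rewrite fs.1/=.
  by have := fs.1 (- x) (- y); rewrite -opprD !fN; lra.
have fpZ r x : 0 < r -> f (r *: x) = r * f x.
  move=> r0; apply/le_anti; rewrite fs.2//=.
  by rewrite -ler_pdivlMl//; have := fs.2 r^-1 (r *: x);
    rewrite scalerK ?gt_eqF// invr_gt0; exact.
have flin : linear (f : E -> R^o).
  move=> r x y; rewrite fD; congr (_ + _).
  have [r0|r0|->] := ltgtP r 0; last by rewrite scale0r sublinear0// scale0r.
    rewrite -[r]opprK scaleNr fN fpZ ?oppr_gt0// opprK.
    by rewrite mulNr opprK.
  exact: fpZ.
pose fL : {linear E -> R^o} :=
  HB.pack (f : E -> R^o) (GRing.isLinear.Build R E R^o *:%R f flin).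
exists fL; split.
  by move=> x /=; exact: le_trans (fp x) (pn x).
move=> x Sx /=; rewrite -[f x]opprK -fN lerNr.
exact: le_trans (fp _) (pS _ Sx).
Qed.

End HahnBanach.

(** * The real line as a normed f-algebra *)

(** An alias of R, so that the vector lattice structure is not attached to R
    itself, which already carries its own order. *)
Definition real_falg (R : realType) : Type := R^o.

HB.instance Definition _ (R : realType) :=
  NormedModule.copy (real_falg R) R^o.

Section RealFAlgebra.
Variable R : realType.
Implicit Types x y z : R.

Let rle_vmeet x y z : x <= Num.min y z <-> x <= y /\ x <= z.
Proof. by rewrite le_min; split=> /andP. Qed.

Let rvjoin_le x y z : Num.max x y <= z <-> x <= z /\ y <= z.
Proof. by rewrite ge_max; split=> /andP. Qed.

Let rleD2l z x y : x <= y -> z + x <= z + y.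
Proof. by rewrite lerD2l. Qed.

HB.instance Definition _ := Lmodule_isVectorLattice.Build R (real_falg R)
  (fun x => @lexx _ R x) (fun x y (xy : (x <= y :> R)) yx => le_anti (andb_true_intro (conj xy yx)))
  (fun x y z (xy : (x <= y :> R)) => @le_trans _ R y x z xy)
  rle_vmeet rvjoin_le rleD2l (@mulr_ge0 R).

HB.instance Definition _ := VectorLattice_isVectorLatticeAlgebra.Build R
  (real_falg R) (@mulrA R) (@mulrDl R) (@mulrDr R)
  (fun c x y => esym (@mulrA R c x y)) (fun c x y => @mulrCA R x c y)
  (@mulr_ge0 R).

Let rfalg_meetl (a b c : R) :
  Num.min a b = 0 -> 0 <= c -> Num.min (a * c) b = 0.
Proof.
have [ab a0|ab b0] := leP a b => c0; first by rewrite a0 mul0r min_l// -a0.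
by rewrite b0 min_r// mulr_ge0// ltW// -b0.
Qed.

Let rfalg_meetr (a b c : R) :
  Num.min a b = 0 -> 0 <= c -> Num.min (c * a) b = 0.
Proof. by rewrite mulrC; exact: rfalg_meetl. Qed.

HB.instance Definition _ := VectorLatticeAlgebra_isFAlgebra.Build R
  (real_falg R) rfalg_meetl rfalg_meetr.

Let rnorm_le (x y : R) : Num.max x (- x) <= Num.max y (- y) -> `|x| <= `|y|.
Proof. by rewrite !maxrN. Qed.

Let rnormM (x y : R) : `|x * y| <= `|x| * `|y|.
Proof. by rewrite normrM. Qed.

HB.instance Definition _ := FAlgebra_isNormed.Build R (real_falg R)
  rnorm_le rnormM.

End RealFAlgebra.

(** * Sub-f-algebras *)

Section SubFAlgebra.
Variables (R : realType) (F : normedFAlgType R).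

(** The closure proofs are bundled with the predicate so that the algebra
    structure of the subtype below can be inferred from it. *)
Record subfalg := SubFAlg {
  sf_carrier :> F -> Prop;
  sf0 : sf_carrier 0;
  sfD : forall x y, sf_carrier x -> sf_carrier y -> sf_carrier (x + y);
  sfZ : forall c x, sf_carrier x -> sf_carrier (c *: x);
  sfJ : forall x y, sf_carrier x -> sf_carrier y -> sf_carrier (vjoin x y);
  sfI : forall x y, sf_carrier x -> sf_carrier y -> sf_carrier (vmeet x y);
  sfM : forall x y, sf_carrier x -> sf_carrier y -> sf_carrier (x *a y)
}.

Variable P : subfalg.

Definition sf_pred : {pred F} := fun x => `[< P x >].

Let submod_sf : submod_closed sf_pred.
Proof.
split=> [|c x y /asboolP Px /asboolP Py]; apply/asboolP; first exact: sf0.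
by apply: sfD => //; exact: sfZ.
Qed.

HB.instance Definition _ := GRing.isSubmodClosed.Build R F sf_pred submod_sf.

Definition sf_sort : Type := {x : F | sf_pred x}.
HB.instance Definition _ := SubType.on sf_sort.
HB.instance Definition _ := Choice.on sf_sort.
HB.instance Definition _ := [SubChoice_isSubLmodule of sf_sort by <:].

Let valB (x : sf_sort) : P (val x).
Proof. by apply/asboolP; exact: (valP x). Qed.

Let sfnorm (x : sf_sort) : R := `|val x|.

Let sfnormD x y : sfnorm (x + y) <= sfnorm x + sfnorm y.
Proof. exact: ler_normD. Qed.
Let sfnormZ (l : R) x : sfnorm (l *: x) = `|l| * sfnorm x.
Proof. exact: normrZ. Qed.
Let sfnorm0 x : sfnorm x = 0 -> x = 0.
Proof. by move=> /normr0_eq0 x0; apply: val_inj. Qed.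

HB.instance Definition _ := Lmodule_isNormed.Build R sf_sort
  sfnormD sfnormZ sfnorm0.

Let sfle (x y : sf_sort) : Prop := val x <=v val y.
Let sfmk x (Px : P x) : sf_sort := exist _ x (asboolT Px).
Let sfmeet (x y : sf_sort) : sf_sort := sfmk (sfI (valB x) (valB y)).
Let sfjoin (x y : sf_sort) : sf_sort := sfmk (sfJ (valB x) (valB y)).
Let sfmul (x y : sf_sort) : sf_sort := sfmk (sfM (valB x) (valB y)).

Let sfle_refl x : sfle x x. Proof. exact: vle_refl. Qed.
Let sfle_anti x y : sfle x y -> sfle y x -> x = y.
Proof. by move=> xy yx; apply: val_inj; exact: vle_anti. Qed.
Let sfle_trans x y z : sfle x y -> sfle y z -> sfle x z.
Proof. exact: vle_trans. Qed.
Let sfle_meet x y z : sfle x (sfmeet y z) <-> sfle x y /\ sfle x z.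
Proof. exact: vle_vmeet. Qed.
Let sfjoin_le x y z : sfle (sfjoin x y) z <-> sfle x z /\ sfle y z.
Proof. exact: vjoin_vle. Qed.
Let sfleD2l z x y : sfle x y -> sfle (z + x) (z + y).
Proof. exact: vleD2l. Qed.
Let sfscale_ge0 (c : R) (x : sf_sort) : 0 <= c -> sfle 0 x -> sfle 0 (c *: x).
Proof. exact: scale_vge0. Qed.

HB.instance Definition _ := Lmodule_isVectorLattice.Build R sf_sort
  sfle_refl sfle_anti sfle_trans sfle_meet sfjoin_le sfleD2l sfscale_ge0.

Let sfmulA : associative sfmul.
Proof. by move=> x y z; apply: val_inj; exact: amulA. Qed.
Let sfmulDl : left_distributive sfmul +%R.
Proof. by move=> x y z; apply: val_inj; exact: amulDl. Qed.
Let sfmulDr : right_distributive sfmul +%R.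
Proof. by move=> x y z; apply: val_inj; exact: amulDr. Qed.
Let sfmulZl (c : R) (x y : sf_sort) : sfmul (c *: x) y = c *: sfmul x y.
Proof. by apply: val_inj; exact: amulZl. Qed.
Let sfmulZr (c : R) (x y : sf_sort) : sfmul x (c *: y) = c *: sfmul x y.
Proof. by apply: val_inj; exact: amulZr. Qed.
Let sfmul_ge0 (x y : sf_sort) : sfle 0 x -> sfle 0 y -> sfle 0 (sfmul x y).
Proof. exact: amul_ge0. Qed.

HB.instance Definition _ := VectorLattice_isVectorLatticeAlgebra.Build R sf_sort
  sfmulA sfmulDl sfmulDr sfmulZl sfmulZr sfmul_ge0.

Let sf_meetl (a b c : sf_sort) :
  vmeet a b = 0 -> 0 <=v c -> vmeet (a *a c) b = 0.
Proof. by move=> /(congr1 val)/= ab c0; apply: val_inj; exact: falg_meetl. Qed.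
Let sf_meetr (a b c : sf_sort) :
  vmeet a b = 0 -> 0 <=v c -> vmeet (c *a a) b = 0.
Proof. by move=> /(congr1 val)/= ab c0; apply: val_inj; exact: falg_meetr. Qed.

HB.instance Definition _ := VectorLatticeAlgebra_isFAlgebra.Build R sf_sort
  sf_meetl sf_meetr.

Let sf_norm_le (x y : sf_sort) : vmodulus x <=v vmodulus y -> `|x| <= `|y|.
Proof. exact: (@nfalg_norm_le R F (val x) (val y)). Qed.
Let sf_normM (x y : sf_sort) : `|x *a y| <= `|x| * `|y|.
Proof. exact: (@nfalg_normM R F (val x) (val y)). Qed.

HB.instance Definition _ := FAlgebra_isNormed.Build R sf_sort
  sf_norm_le sf_normM.

End SubFAlgebra.

(** * Free normed f-algebras *)

Section OperatorNorm.
Variables (R : realType) (E F : normedModType R).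

Lemma opnorm_leP (T : {linear E -> F}) (t : R) : 0 <= t ->
  (opnorm T <= t%:E)%E <-> forall x, `|T x| <= t * `|x|.
Proof.
move=> t0; split=> [Tt x|Tt]; last first.
  apply: ge_ereal_sup => _ [x /= x1 <-]; rewrite lee_fin.
  by apply: le_trans (Tt x) _; rewrite ler_piMr.
have [->|x0] := eqVneq x 0; first by rewrite linear0 !normr0 mulr0.
have nx : 0 < `|x| by rewrite normr_gt0.
have : (`|T (`|x|^-1 *: x)|%:E <= opnorm T)%E.
  by apply: ereal_sup_ubound; exists (`|x|^-1 *: x) => //=; rewrite normfZV.
move=> /le_trans/(_ Tt); rewrite lee_fin linearZ normrZ ger0_norm ?invr_ge0//.
by rewrite ler_pdivrMl// mulrC.
Qed.

End OperatorNorm.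

Lemma hom_vle (R : realType) (A B : vectorLatticeAlgType R)
    (h : {linear A -> B}) x y : lattice_algebra_hom h ->
  x <=v y -> h x <=v h y.
Proof.
move=> [_ hU _] xy.
suff <- : vjoin x y = y by rewrite hU; exact: vleUl.
apply: vle_anti; last exact: vleUr.
by apply/vjoin_vle; split=> //; exact: vle_refl.
Qed.

Section FreeNormedFAlgebra.
Variables (R : realType) (E : completeNormedModType R) (F : normedFAlgType R).
Variables (eta : {linear E -> F}) (eta_free : is_free_normed_falgebra eta).

(** F is generated by eta(E).  The universal property yields a homomorphism
    h : F -> P with h (eta x) = eta x; composed with the inclusion of P it is an
    endomorphism of F fixing eta(E), hence the identity by uniqueness. *)
Lemma free_falgebra_ind (P : subfalg F) :
  (forall x, P (eta x)) -> forall y, P y.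
Proof.
move=> Peta.
pose g (x : E) : sf_sort P := exist _ (eta x) (asboolT (Peta x)).
have g_lin : linear g by move=> c x y; apply: val_inj; exact: linearP.
pose gL : {linear E -> sf_sort P} :=
  HB.pack g (GRing.isLinear.Build R E (sf_sort P) *:%R g g_lin).
have [eta_iso univ] := eta_free.
have gc : contractive gL.
  by apply/opnorm_leP => // x; rewrite mul1r -eta_iso; exact: lexx.
have etac : contractive eta.
  by apply/opnorm_leP => // x; rewrite mul1r eta_iso.
have [h [[hI hU hM] hg _ _]] := univ _ _ gc.
have [k [_ _ _ k_uniq]] := univ _ _ etac.
have idF : lattice_algebra_hom (idfun : {linear F -> F}) by [].
pose hF (y : F) : F := val (h y).
have hF_lin : linear hF by move=> c x y; rewrite /hF linearP.
pose hFL : {linear F -> F} :=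
  HB.pack hF (GRing.isLinear.Build R F F *:%R hF hF_lin).
have hFh : lattice_algebra_hom hFL.
  by split=> x y; rewrite /= /hF ?hI ?hU ?hM.
move=> y; have /asboolP := valP (h y).
have -> : val (h y) = y; last by [].
transitivity (k y); last by rewrite -(k_uniq _ idF).
by apply: (k_uniq hFL hFh) => x /=; rewrite /hF hg.
Qed.

(** The set {e | u <= eta e} is convex, and its elements satisfy
    |e| = |eta e| >= |u^+| because eta is isometric and u^+ <= |eta e|. *)
Lemma free_functional_separation u : fin_meets (range eta) u ->
  exists f : {linear E -> R^o}, (forall x, f x <= `|x|) /\
    forall e, u <=v eta e -> `|vpos u| <= f e.
Proof.
move=> Mu; have [eta_iso _] := eta_free.
apply: (hahn_banach_convex (S := [set e | u <=v eta e])).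
- by have [_ [e _ <-] ue] := fin_meets_has_ge Mu; exists e.
- move=> x y a b /= ux uy a0 b0 ab.
  rewrite linearD !linearZ /= -[u]scale1r -ab scalerDl.
  by apply: vle_add; exact: vle_scale.
- move=> e /= ue; rewrite -eta_iso; apply: nfalg_norm_le.
  have le_mod : vpos u <=v vmodulus (eta e).
    by apply: vpos_le; [exact: vmodulus_ge0|exact: vle_trans ue (vleUl _ _)].
  apply/vjoin_vle; split => //; apply: vle_trans (vmodulus_ge0 (eta e)).
  by rewrite -oppr0; apply/vle_opp; exact: vpos_ge0.
Qed.

(** Homomorphisms to R of norm at most t; the factor t is what makes the image
    of a square quadratic in t. *)
Definition real_hom (t : R) (h : {linear F -> real_falg R}) :=
  lattice_algebra_hom h /\ forall y, `|h y| <= t * `|y|.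

Lemma real_hom_extension (f : {linear E -> R^o}) t :
    (forall x, f x <= `|x|) -> 0 <= t <= 1 ->
  exists2 h, real_hom t h & forall x, h (eta x) = t * f x :> R.
Proof.
move=> f1 /andP[t0 t1].
have nf x : `|f x| <= `|x|.
  by rewrite ler_norml f1 andbT lerNl -linearN -normrN f1.
pose g (x : E) : real_falg R := t *: f x.
have g_lin : linear g.
  by move=> c x y; rewrite /g linearP scalerDr scalerA mulrC -scalerA.
pose gL : {linear E -> real_falg R} :=
  HB.pack g (GRing.isLinear.Build R E (real_falg R) *:%R g g_lin).
have gt x : `|gL x| <= t * `|x|.
  by rewrite normrZ ger0_norm// ler_wpM2l.
have gc : contractive gL.
  by apply/opnorm_leP => // x; apply: le_trans (gt x) _; rewrite ler_wpM2r.
have [h [hh hg hn _]] := eta_free.2 _ _ gc.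
exists h => //; split => //; apply/opnorm_leP => //.
by rewrite hn; apply/opnorm_leP.
Qed.

(** For a finite meet u <= l, the extension of t f with f from
    [free_functional_separation] gives t |u^+| <= h u <= h l <= t^2 C, so
    |u^+| <= t C for all small t. *)
Lemma lattice_expr_le0 l (C : R) : lattice_expr eta l -> 0 <= C ->
    (forall t h, 0 <= t <= 1 -> real_hom t h -> (h l : R) <= t * t * C) ->
  l <=v 0.
Proof.
move=> Ll C0 lC; apply: (fin_joins_le Ll) => u Mu ul.
have [f [f1 fu]] := free_functional_separation Mu.
apply/vpos_eq0/eqP; rewrite -normr_eq0 eq_le normr_ge0 andbT leNgt.
set n := `|vpos u| in fu *; apply/negP => n0.
have nC : 0 < n + C by rewrite ltr_wpDr.
(* This t satisfies both t <= 1 and t C < n. *)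
pose t := n / (n + C).
have t0 : 0 < t by rewrite divr_gt0.
have t01 : 0 <= t <= 1 by rewrite ltW//= ler_pdivrMr// mul1r lerDl.
have [h hh heta] := real_hom_extension f1 t01.
have [hI _ _] := hh.1.
have le_hu : t * n <= (h u : R).
  apply: (fin_meets_ge (d := t * n : real_falg R) hI Mu) => _ [e _ <-] ue.
  by rewrite heta; apply: ler_wpM2l (fu e ue); exact: ltW.
have hul : (h u : R) <= h l by exact: (hom_vle hh.1 ul).
have := le_trans le_hu (le_trans hul (lC t h t01 hh)).
rewrite -mulrA ler_pM2l// /t -mulrA -[leLHS]mulr1 ler_pM2l//.
by rewrite mulrC ler_pdivlMr// mul1r leNgt ltrDr n0.
Qed.

(** The error term is a single square, so that a homomorphism of norm at most t
    makes it O(t^2). *)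
Definition lattice_approx (a : F) := exists l b,
  [/\ lattice_expr eta l, 0 <=v b, a <=v l + b *a b & l <=v a + b *a b].

Lemma sqrD_ge (b c : F) : 0 <=v b -> 0 <=v c ->
  b *a b + c *a c <=v (b + c) *a (b + c).
Proof.
move=> b0 c0; rewrite amulDr !amulDl; apply: vle_add.
  by apply: vle_addl; exact: amul_ge0.
by apply: vle_addr; exact: amul_ge0.
Qed.

Lemma sqrDl_ge (b c : F) : 0 <=v b -> 0 <=v c -> b *a b <=v (b + c) *a (b + c).
Proof.
move=> b0 c0; apply: vle_trans (sqrD_ge b0 c0).
by apply: vle_addl; exact: amul_ge0.
Qed.

Lemma sqrDr_ge (b c : F) : 0 <=v b -> 0 <=v c -> c *a c <=v (b + c) *a (b + c).
Proof. by move=> b0 c0; rewrite addrC; exact: sqrDl_ge. Qed.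

Lemma lattice_approxD x y :
  lattice_approx x -> lattice_approx y -> lattice_approx (x + y).
Proof.
move=> [l [b [Ll b0 xl lx]]] [m [c [Lm c0 ym my]]].
exists (l + m), (b + c); split; first exact: lattice_exprD.
- exact: vadd_ge0.
- apply: vle_trans (vle_add xl ym) _; rewrite addrACA; apply/vle_add2l.
  exact: sqrD_ge.
- apply: vle_trans (vle_add lx my) _; rewrite addrACA; apply/vle_add2l.
  exact: sqrD_ge.
Qed.

Lemma lattice_approxN x : lattice_approx x -> lattice_approx (- x).
Proof.
move=> [l [b [Ll b0 xl lx]]]; exists (- l), b; split => //.
- exact: lattice_exprN.
- exact: vle_opp_add.
- exact: vle_opp_add.
Qed.

Lemma lattice_approx_scale_ge0 c x : 0 <= c ->
  lattice_approx x -> lattice_approx (c *: x).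
Proof.
move=> c0 [l [b [Ll b0 xl lx]]]; exists (c *: l), (Num.sqrt c *: b).
rewrite amulZl amulZr scalerA -expr2 sqr_sqrtr// -!scalerDr; split.
- exact: lattice_exprZ.
- by apply: scale_vge0 => //; exact: sqrtr_ge0.
- exact: vle_scale.
- exact: vle_scale.
Qed.

Lemma lattice_approxZ c x : lattice_approx x -> lattice_approx (c *: x).
Proof.
have [c0|/ltW c0] := leP 0 c; first exact: lattice_approx_scale_ge0.
move=> Gx; rewrite -[c]opprK scaleNr; apply: lattice_approxN.
by apply: lattice_approx_scale_ge0; rewrite ?oppr_ge0.
Qed.

Lemma lattice_approxJ x y :
  lattice_approx x -> lattice_approx y -> lattice_approx (vjoin x y).
Proof.
move=> [l [b [Ll b0 xl lx]]] [m [c [Lm c0 ym my]]].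
exists (vjoin l m), (b + c); split; first exact: lattice_exprJ.
- exact: vadd_ge0.
- rewrite vjoinDr; apply: vle_join2.
    by apply: vle_trans xl _; apply/vle_add2l; exact: sqrDl_ge.
  by apply: vle_trans ym _; apply/vle_add2l; exact: sqrDr_ge.
- rewrite vjoinDr; apply: vle_join2.
    by apply: vle_trans lx _; apply/vle_add2l; exact: sqrDl_ge.
  by apply: vle_trans my _; apply/vle_add2l; exact: sqrDr_ge.
Qed.

Lemma lattice_approxI x y :
  lattice_approx x -> lattice_approx y -> lattice_approx (vmeet x y).
Proof.
move=> Gx Gy; rewrite -[vmeet x y]opprK voppI.
by apply/lattice_approxN/lattice_approxJ; exact: lattice_approxN.
Qed.

Lemma lattice_approx_gen e : lattice_approx (eta e).
Proof.
exists (eta e), 0; rewrite amul0l addr0.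
by split; (exact: lattice_expr_gen || exact: vle_refl).
Qed.

(** A product is all error: l = 0 approximates it. *)
Lemma lattice_approxM x y : lattice_approx (x *a y).
Proof.
exists 0, (vmodulus x + vmodulus y); rewrite add0r; split.
- by rewrite -(linear0 eta); exact: lattice_expr_gen.
- by apply: vadd_ge0; exact: vmodulus_ge0.
- exact: amul_le_sqr.
- apply/(vle_add2l (- (x *a y))); rewrite addr0 addKr -amulNl -(vmodulusN x).
  exact: amul_le_sqr.
Qed.

Lemma lattice_approx0 : lattice_approx 0.
Proof. by rewrite -(linear0 eta); exact: lattice_approx_gen. Qed.

Lemma lattice_approx_all a : lattice_approx a.
Proof.
exact: (free_falgebra_ind (P := SubFAlg lattice_approx0 lattice_approxD
  lattice_approxZ lattice_approxJ lattice_approxI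
  (fun x y _ _ => lattice_approxM x y)) lattice_approx_gen).
Qed.

(** A homomorphism h : F -> R of norm at most t kills a, since h(a)^2 = h(a^2);
    hence h l <= (h b)^2 <= t^2 |b|^2. *)
Lemma annihilator_approx_le0 a l b : annihilator a -> lattice_expr eta l ->
  l <=v a + b *a b -> l <=v 0.
Proof.
move=> Na Ll lab; apply: (lattice_expr_le0 (C := `|b| * `|b|) Ll).
  exact: mulr_ge0.
move=> t h /andP[t0 _] [hh ht]; have [_ _ hM] := hh.
have ha : (h a : R) = 0.
  have : (h a : R) * h a = 0.
    by rewrite -[_ * _](hM a a) Na linear0.
  by move/eqP; rewrite mulf_eq0 orbb => /eqP.
have /le_trans : (h l : R) <= h (a + b *a b) by exact: (hom_vle hh lab).
apply; rewrite linearD hM ha [leLHS]add0r mulrACA.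
apply: le_trans (ler_norm _) _; rewrite normrM.
by apply: ler_pM.
Qed.

End FreeNormedFAlgebra.

Theorem proposition4p15 (R : realType) (E : completeNormedModType R)
    (F : normedFAlgType R) (eta : {linear E -> F}) :
  is_free_normed_falgebra eta -> semiprime F.
Proof.
move=> eta_free; apply/seteqP; split=> [a Na|_ -> b]; last exact: amul0l.
have [l [b [Ll b0 al la]]] := lattice_approx_all eta_free a.
have l0 : l <=v 0 := annihilator_approx_le0 eta_free Na Ll la.
have NaN : annihilator (- a) by move=> c; rewrite amulNl Na oppr0.
have lN0 : - l <=v 0.
  exact: (annihilator_approx_le0 eta_free NaN (lattice_exprN Ll)
    (vle_opp_add al)).
have {l0 lN0}l0 : l = 0.
  by apply: vle_anti => //; apply/vle_opp; rewrite oppr0.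
move: al la; rewrite l0 add0r => ab Nab.
apply: (annihilator_sqr_bound Na b0 ab).
by apply/(vle_add2l a); rewrite subrr.
Qed.
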